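(* Let $t,A,x,y,z$ be real numbers with $t\neq 0$ and $A,x,y,z\notin\{0,1,-1\}$. Then $(t,A,x,y,z)$ satisfies \[ \sqrt{t \left(1 - \frac{1}{A^2}\right)\left(1 - \frac{1}{x^2}\right)\left(1 - \frac{1}{y^2}\right)\left(1 - \frac{1}{z^2}\right)} = \left(1 + \frac{1}{x}\right)\left(1 + \frac{1}{y}\right)\left(1 + \frac{1}{z}\right) \qquad (\ast) \] if and only if there exists a real number $k\neq 0$ such that, setting \[ \gamma=[(A^2-1)t-A^2]kz-[(A^2-1)t+A^2]k,\qquad \beta=[(A^2-1)t+A^2]kz-[(A^2-1)t-A^2]k-1, \] we have $\gamma^2-4\beta\ge 0$, $\beta\neq 0$, $1-\gamma+\beta\neq 0$, and $x$ and $y$ are the (real) roots of the quadratic equation $X^2-\gamma X+\beta=0$.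
   Context: A nontrivial real solution of $(\ast)$ means a real tuple $(t,A,x,y,z)$ satisfying $(\ast)$ with $t\neq 0$ and none of $A,x,y,z$ in $\{0,\pm1\}$.
   Formalization: The radical in (∗) is read as either real square root of a nonnegative radicand; with the principal root the ''if'' direction fails, e.g. t=-4, A=2, x=-1/2, y=z=2, k=-1/16, where the left side is 9/4 and the right side is -9/4. *)

(* Defs.v *)
From Stdlib Require Import Reals Lra.
Open Scope R_scope.

Definition radicand (t A x y z : R) : R :=
  t * (1 - 1 / A ^ 2) * (1 - 1 / x ^ 2) * (1 - 1 / y ^ 2) * (1 - 1 / z ^ 2).

Definition rhs (x y z : R) : R := (1 + 1 / x) * (1 + 1 / y) * (1 + 1 / z).

(* The equation sqrt (radicand t A x y z) = rhs x y z, where the radical sign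
   stands for either real square root.  The nonnegative root alone would be too
   restrictive for the parametrization by k: for
   (t, A, x, y, z) = (-4, 2, -1/2, 2, 2) and k = -1/16 all the conditions on
   gamma and beta hold, while the radicand is 81/16 and rhs is -9/4.
   The first conjunct is needed because [sqrt] is 0 on negative reals. *)
Definition satisfies_equation (t A x y z : R) : Prop :=
  0 <= radicand t A x y z /\
  (sqrt (radicand t A x y z) = rhs x y z \/
   - sqrt (radicand t A x y z) = rhs x y z).

Definition nontrivial (a : R) : Prop := a <> 0 /\ a <> 1 /\ a <> -1.

Definition gamma (t A z k : R) : R :=
  ((A ^ 2 - 1) * t - A ^ 2) * k * z - ((A ^ 2 - 1) * t + A ^ 2) * k.

Definition beta (t A z k : R) : R :=
  ((A ^ 2 - 1) * t + A ^ 2) * k * z - ((A ^ 2 - 1) * t - A ^ 2) * k - 1.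

(* x and y are all the real roots of X^2 - g X + b; over R, when x = y this
   forces x to be a double root. *)
Definition are_the_roots (g b x y : R) : Prop :=
  forall X : R, X ^ 2 - g * X + b = 0 <-> X = x \/ X = y.

(* Main.v *)
Require Import Defs.
From Stdlib Require Import Reals Lra.
Open Scope R_scope.

(** Squaring and cancelling the nonzero factor [(1 + 1/x) (1 + 1/y) (1 + 1/z)]
    turns the equation into
    [(A^2 - 1) t (x - 1) (y - 1) (z - 1) = A^2 (x + 1) (y + 1) (z + 1)].
    The parameter [k] is the proportionality factor in
    [(x + 1) (y + 1) = 2 k (A^2 - 1) t (z - 1)] and
    [(x - 1) (y - 1) = 2 k A^2 (z + 1)], and solving these two relations for
    [x + y] and [x y] gives [gamma] and [beta]. *)

(** Since [sqrt (b ^ 2)] is the absolute value of [b], one of the two signs always yields [b]. *)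
Lemma signed_sqrt_eq_iff (a b : R) :
  0 <= a /\ (sqrt a = b \/ - sqrt a = b) <-> a = b ^ 2.
Proof.
split.
- intros [ha h]. rewrite <- (pow2_sqrt a ha). destruct h as [h | h]; subst b; ring.
- intros ->. split; [apply pow2_ge_0 |].
  rewrite <- Rsqr_pow2, sqrt_Rsqr_abs. unfold Rabs; destruct (Rcase_abs b); lra.
Qed.

Lemma satisfies_equation_iff (t A x y z : R) :
  nontrivial A -> nontrivial x -> nontrivial y -> nontrivial z ->
  satisfies_equation t A x y z <->
  (A ^ 2 - 1) * t * ((x - 1) * (y - 1) * (z - 1)) =
    A ^ 2 * ((x + 1) * (y + 1) * (z + 1)).
Proof.
intros [A0 _] [x0 [_ x1]] [y0 [_ y1]] [z0 [_ z1]].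
unfold satisfies_equation. rewrite signed_sqrt_eq_iff.
(* Common factor of [radicand] and [rhs ^ 2] over the denominator [(A * x * y * z) ^ 2]; nonzero
   because [x], [y], [z] differ from -1. *)
set (c := (x + 1) * (y + 1) * (z + 1) / (A * x * y * z) ^ 2).
assert (hc : c <> 0).
{ unfold c, Rdiv. repeat apply Rmult_integral_contrapositive_currified; try lra.
  apply Rinv_neq_0_compat, pow_nonzero.
  repeat apply Rmult_integral_contrapositive_currified; assumption. }
assert (key : radicand t A x y z - rhs x y z ^ 2 =
  c * ((A ^ 2 - 1) * t * ((x - 1) * (y - 1) * (z - 1)) -
       A ^ 2 * ((x + 1) * (y + 1) * (z + 1)))).
{ unfold c, radicand, rhs. field. auto. }
split; intros h.
- rewrite h, Rminus_diag in key.
  destruct (Rmult_integral _ _ (eq_sym key)); [contradiction | lra].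
- rewrite h, Rminus_diag, Rmult_0_r in key. lra.
Qed.

Lemma are_the_roots_iff (g b x y : R) :
  are_the_roots g b x y <-> g = x + y /\ b = x * y.
Proof.
split.
- intros h.
  assert (hx := proj2 (h x) (or_introl eq_refl)).
  (* The conjugate root [g - x] must be [x] or [y]. *)
  assert (hg : (g - x) ^ 2 - g * (g - x) + b = 0) by (rewrite <- hx; ring).
  destruct (proj1 (h _) hg) as [e | e].
  + assert (hy := proj2 (h y) (or_intror eq_refl)).
    assert (g = 2 * x) by lra. subst g.
    (* With [g = 2 * x], [hx] gives [b = x ^ 2], so the quadratic is [(X - x) ^ 2] and vanishes at
       [y]. *)
    assert (sq : Rsqr (y - x) = 0) by (unfold Rsqr; lra).
    apply Rsqr_0_uniq in sq. assert (y = x) by lra. subst y. split; lra.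
  + assert (g = x + y) by lra. subst g. split; lra.
- intros [-> ->] X.
  replace (X ^ 2 - (x + y) * X + x * y) with ((X - x) * (X - y)) by ring.
  split.
  + intros h. destruct (Rmult_integral _ _ h); [left | right]; lra.
  + intros [-> | ->]; ring.
Qed.

Theorem theorem1p1 (t A x y z : R)
  (ht : t <> 0) (hA : nontrivial A)
  (hx : nontrivial x) (hy : nontrivial y) (hz : nontrivial z) :
  satisfies_equation t A x y z <->
  exists k : R,
    k <> 0 /\
    0 <= gamma t A z k ^ 2 - 4 * beta t A z k /\
    beta t A z k <> 0 /\
    1 - gamma t A z k + beta t A z k <> 0 /\
    are_the_roots (gamma t A z k) (beta t A z k) x y.
Proof.
rewrite satisfies_equation_iff by assumption.
destruct hA as [A0 _], hx as [x0 [x1 _]], hy as [y0 [y1 _]], hz as [_ [_ z1]].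
assert (hA2 : A ^ 2 <> 0) by (apply pow_nonzero; assumption).
assert (hxy : (x - 1) * (y - 1) <> 0)
  by (apply Rmult_integral_contrapositive_currified; lra).
assert (hz1 : z + 1 <> 0) by lra.
split.
- intros h.
  (* [k] is solved from [minus]; [plus] then follows from [h] after cancelling [A ^ 2 * (z + 1)]. *)
  set (k := (x - 1) * (y - 1) / (2 * A ^ 2 * (z + 1))).
  assert (minus : (x - 1) * (y - 1) = 2 * k * A ^ 2 * (z + 1))
    by (unfold k; field; auto).
  assert (plus : (x + 1) * (y + 1) = 2 * k * ((A ^ 2 - 1) * t) * (z - 1)).
  { apply Rmult_eq_reg_l with (A ^ 2 * (z + 1)).
    - transitivity ((A ^ 2 - 1) * t * (z - 1) * ((x - 1) * (y - 1))); [lra |].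
      rewrite minus; ring.
    - apply Rmult_integral_contrapositive_currified; assumption. }
  (* Half of [plus] minus [minus] is [x + y]; half of their sum is [x * y + 1]. *)
  assert (hg : gamma t A z k = x + y) by (unfold gamma; lra).
  assert (hb : beta t A z k = x * y) by (unfold beta; lra).
  exists k. rewrite are_the_roots_iff, hg, hb. repeat split.
  + intros k0. apply hxy. rewrite minus, k0. ring.
  + replace ((x + y) ^ 2 - 4 * (x * y)) with ((x - y) ^ 2) by ring.
    apply pow2_ge_0.
  + apply Rmult_integral_contrapositive_currified; assumption.
  (* Here [1 - gamma + beta] is [(x - 1) * (y - 1)]. *)
  + lra.
- intros [k [_ [_ [_ [_ roots]]]]].
  apply are_the_roots_iff in roots. destruct roots as [hg hb].
  unfold gamma in hg. unfold beta in hb.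
  (* The two relations are [1 - gamma + beta] and [1 + gamma + beta] written out. Substituting them
     makes both sides [2 * k * A ^ 2 * (A ^ 2 - 1) * t * (z ^ 2 - 1)]. *)
  assert (minus : (x - 1) * (y - 1) = 2 * k * A ^ 2 * (z + 1)) by lra.
  assert (plus : (x + 1) * (y + 1) = 2 * k * ((A ^ 2 - 1) * t) * (z - 1)) by lra.
  rewrite minus, plus. ring.
Qed.
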